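(* Let $\Delta$ be a simplicial complex on $\{1,\ldots,K\}$, $\mathbf{n}$ a table, and $\Gamma$ a chordal triangulation of $\Delta$ with facets $\Gamma_1,\ldots,\Gamma_s$. Denote by $\mathbf{n}_t$ the $\Gamma_t$-margin of $\mathbf{n}$. Then $F^\Delta_{\mathbf{n}}$ is equal to the orthogonal complement of the linear hull of $P_\Delta$ if and only if the polyhedron \[(F^{\Gamma_1}_{\mathbf{n}_1}\times\cdots\times F^{\Gamma_s}_{\mathbf{n}_s})\cap\Bigl\{(\mathbf{c}_1,\ldots,\mathbf{c}_s): \sum_{t:\,F\subseteq\Gamma_t}\mathbf{c}_t^F=\mathbf{0}\text{ for all }F\in\Gamma\setminus\Delta\Bigr\}\] is a linear space. Furthermore, if $\Delta$ has bounded tree width, the description of this polyhedron in terms of inequalities and equations has size polynomial in the number of levels of each random variable, the number of random variables and the bit complexity of $\mathbf{n}$, and the dimension of its ambient space is polynomial in the input.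
   Context: Random variables $X_1,\ldots,X_K$ with $X_j$ taking values in $[d_j]$ (the levels); for $V\subseteq\{1,\ldots,K\}$, $d_V=\bigotimes_{j\in V}[d_j]$ and $i_V$ is the restriction of a cell $i$ to $V$; $d=d_{\{1,\ldots,K\}}$ and tables are elements of $\mathbb{R}^d$. The margin of $\mathbf{n}$ with respect to $V$ is $j\mapsto\sum_{i:i_V=j}\mathbf{n}(i)$ on $d_V$. For a simplicial complex $\Sigma$ with vertex set $V$ and a table $\mathbf{m}$ on $V$, $A_\Sigma$ has columns indexed by $d_V$ and rows indexed by pairs $(F,j_F)$ with $F$ a face of $\Sigma$ and $j_F\in d_F$; row $(F,j_F)$ is the indicator of $\{i: i_F=j_F\}$. A vector $\mathbf{c}$ in the row-index space splits into blocks $\mathbf{c}^F$, one per face $F$. With $\mathbf{t}=A_\Sigma\mathbf{m}$, $F^\Sigma_{\mathbf{m}}=\{\mathbf{c}:\mathbf{c}^T\mathbf{a}\le\mathbf{c}^T\mathbf{t}\text{ for every column }\mathbf{a}\text{ of }A_\Sigma\}$. $P_\Delta$ is the cone generated by the columns of $A_\Delta$. In $F^{\Gamma_t}_{\mathbf{n}_t}$, $\Gamma_t$ denotes the full simplex on the vertex set $\Gamma_t$ (all its subsets are faces). A simplicial complex is reducible if it has a decomposition $(\Delta_1,S,\Delta_2)$ with $\Delta_1\cup\Delta_2$ equal to it, $|\Delta_1|\cap|\Delta_2|=S$ ($|\cdot|$ = vertex set), and $S$ a face of both; it is decomposable (chordal) if reducible with each $\Delta_k$ decomposable or a simplex. The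 tree width of $\Delta$ is $\min_\Gamma\max_{C\in\Gamma}|C|-1$ over decomposable $\Gamma$ containing all faces of $\Delta$; a decomposable $\Gamma$ attaining this minimum is a chordal triangulation of $\Delta$.
   Formalization: F^Σ_m is taken as the c with c^T a ≤ c^T t for all a in the cone P_Σ, not only for the columns a (literally, the equivalence fails for K=1, n=(1/2,1/2)), and the table n is assumed nonnegative (the equivalence fails for signed tables, e.g. on the binary 4-cycle). *)

(* Defs.v *)
From mathcomp Require Import all_boot all_order all_algebra.

Set Implicit Arguments.
Unset Strict Implicit.
Unset Printing Implicit Defensive.

Import Order.TTheory GRing.Theory Num.Theory.
Local Open Scope ring_scope.

Section Complexes.
Variable K : nat.
Implicit Types (S V C F G : {set 'I_K}) (Sigma Delta Gamma : {set {set 'I_K}}).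

(* Complexes are given by their faces.  The empty set is always a face, and
   points of 'I_K need not be vertices; the vertex set is [cover Sigma]. *)
Definition is_complex Sigma : Prop :=
  set0 \in Sigma /\
  forall F G, G \in Sigma -> F \subset G -> F \in Sigma.

Definition is_simplex Sigma : Prop := exists V, Sigma = powerset V.

Definition decomposition Sigma Sigma1 S Sigma2 : Prop :=
  [/\ is_complex Sigma1, is_complex Sigma2,
      Sigma1 :|: Sigma2 = Sigma,
      cover Sigma1 :&: cover Sigma2 = S &
      S \in Sigma1 /\ S \in Sigma2].

(* The trivial decomposition (Sigma, V, Sigma) makes the simplex Sigma on V
   decomposable. *)
Inductive decomposable : {set {set 'I_K}} -> Prop :=
  Decomposable Sigma Sigma1 S Sigma2 of
    decomposition Sigma Sigma1 S Sigma2 &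
    decomposable Sigma1 \/ is_simplex Sigma1 &
    decomposable Sigma2 \/ is_simplex Sigma2 : decomposable Sigma.

(* An integer, so that the complex whose only face is empty has width -1. *)
Definition width Gamma : int := (\max_(C in Gamma) #|C|)%N%:Z - 1.

Definition chordal_cover Delta Gamma : Prop :=
  decomposable Gamma /\ Delta \subset Gamma.

Definition is_treewidth Delta (w : int) : Prop :=
  (exists2 Gamma, chordal_cover Delta Gamma & width Gamma = w) /\
  (forall Gamma, chordal_cover Delta Gamma -> w <= width Gamma).

Definition chordal_triangulation Delta Gamma : Prop :=
  chordal_cover Delta Gamma /\ is_treewidth Delta (width Gamma).

Definition facets Gamma : {set {set 'I_K}} :=
  [set G | maxset (fun C => C \in Gamma) G].

Definition facet Gamma : finType := {G : {set 'I_K} | G \in facets Gamma}.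

Lemma sub_powersetT Sigma : Sigma \subset powerset [set: 'I_K].
Proof. by apply/subsetP => F _; rewrite powersetE subsetT. Qed.

End Complexes.

Section Vectors.
Variables (R : realFieldType) (T : finType).

Definition vec := {ffun T -> R^o}.

Definition dot (c x : vec) : R := \sum_r (c r : R) * (x r : R).

Definition lin_hull (P : vec -> Prop) (x : vec) : Prop :=
  forall U : {vspace vec}, (forall y, P y -> y \in U) -> x \in U.

Definition orth (P : vec -> Prop) (c : vec) : Prop :=
  forall x, P x -> dot c x = 0.

Definition is_linear_space (P : vec -> Prop) : Prop :=
  exists U : {vspace vec}, forall x, P x <-> x \in U.

(* The homogeneous system  a . c <= 0 (a in ineqs),  a . c = 0 (a in eqs). *)
Record linsys := LinSys { ineqs : seq vec; eqs : seq vec }.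

Definition solves (L : linsys) (c : vec) : Prop :=
  (forall a, a \in ineqs L -> dot a c <= 0) /\
  (forall a, a \in eqs L -> dot a c = 0).

End Vectors.

Section Tables.
Variables (R : realFieldType) (K : nat) (d : 'I_K -> nat).
Implicit Types (V F G : {set 'I_K}) (Sigma Delta Gamma : {set {set 'I_K}}).

Definition cell V : finType :=
  {dffun forall j : {j : 'I_K | j \in V}, 'I_(d (val j))}.

Definition restr F V (sFV : F \subset V) (i : cell V) : cell F :=
  finfun (fun j : {j : 'I_K | j \in F} =>
    i (exist _ (val j) (subsetP sFV _ (valP j)))).

Definition table V := {ffun cell V -> R}.

Definition margin V (n : table [set: 'I_K]) : table V :=
  [ffun j => \sum_(i | restr (subsetT V) i == j) n i].

Definition face_cell : finType := {F : {set 'I_K} & cell F}.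

Definition rowidx Sigma : finType := {r : face_cell | tag r \in Sigma}.

Lemma rowidx_sub V Sigma (sSV : Sigma \subset powerset V) (r : rowidx Sigma) :
  tag (val r) \subset V.
Proof. by rewrite -powersetE (subsetP sSV) // (valP r). Qed.

Definition column V Sigma (sSV : Sigma \subset powerset V) (i : cell V) :
    vec R (rowidx Sigma) :=
  [ffun r => (restr (rowidx_sub sSV r) i == tagged (val r))%:R].

(* The product of the design matrix with m. *)
Definition suff_stat V Sigma (sSV : Sigma \subset powerset V) (m : table V) :
    vec R (rowidx Sigma) :=
  \sum_i m i *: column sSV i.

Definition gen_cone V Sigma (sSV : Sigma \subset powerset V)
    (x : vec R (rowidx Sigma)) : Prop :=
  exists2 l : cell V -> R, forall i, 0 <= l i & x = \sum_i l i *: column sSV i.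

(* With t = suff_stat m, the functionals maximized over the cone at t.  The
   inequality ranges over the whole cone: imposing c . a <= c . t only on the
   columns a would always admit the coordinate functional of the empty face or
   its opposite, which is constant and nonzero on the columns. *)
Definition normal_cone V Sigma (sSV : Sigma \subset powerset V) (m : table V)
    (c : vec R (rowidx Sigma)) : Prop :=
  forall a, gen_cone sSV a -> dot c a <= dot c (suff_stat sSV m).

(* c^F(j) for r = (F, j); the value 0 is only used if F is not a face. *)
Definition block Sigma (c : vec R (rowidx Sigma)) (r : face_cell) : R :=
  oapp c 0 (insub r).

(* vec R (prodidx Gamma) is the product over the facets G of Gamma of the spaces
   vec R (rowidx (powerset G)). *)
Definition prodidx Gamma : finType :=
  {G : facet Gamma & rowidx (powerset (val G))}.

Definition component Gamma (c : vec R (prodidx Gamma)) (G : facet Gamma) :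
    vec R (rowidx (powerset (val G))) :=
  [ffun r => c (Tagged (fun G : facet Gamma => rowidx (powerset (val G))) r)].

Definition polyhedron Delta Gamma (n : table [set: 'I_K])
    (c : vec R (prodidx Gamma)) : Prop :=
  (forall G : facet Gamma,
     normal_cone (subxx (powerset (val G))) (margin (val G) n)
       (component c G)) /\
  (forall F, F \in Gamma :\: Delta -> forall j : cell F,
     \sum_(G : facet Gamma | F \subset val G)
        block (component c G) (Tagged cell j) = 0).

Definition embed Gamma (G : facet Gamma)
    (a : vec R (rowidx (powerset (val G)))) : vec R (prodidx Gamma) :=
  [ffun x => untag (0 : R^o) a x].

(* On each facet G, the normal cone at t is given by c . a <= 0 for the
   columns a, and - t . c <= 0.  The equation for the face cell r = (F, j) sums
   the coordinates r of all components that have one, i.e. with F a subset of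
   the facet. *)
Definition description Delta Gamma (n : table [set: 'I_K]) :
    linsys R (prodidx Gamma) :=
  LinSys
    ([seq embed (column (subxx (powerset (val (tag x)))) (tagged x))
        | x : {G : facet Gamma & cell (val G)}] ++
     [seq - embed (suff_stat (subxx (powerset (val G))) (margin (val G) n))
        | G : facet Gamma])
    [seq [ffun x : prodidx Gamma => (val (tagged x) == r)%:R : R^o]
        | r : face_cell in [pred r | tag r \in Gamma :\: Delta]].

End Tables.

Section Sizes.

Definition nat_bits (m : nat) : nat := (trunc_log 2 m).+1.

Definition rat_bits (q : rat) : nat :=
  (1 + nat_bits `|numq q| + nat_bits `|denq q|)%N.

(* Only nonzero cells are counted: listing all cells would already take space
   exponential in the number of variables. *)
Definition table_bits K (d : 'I_K -> nat) (n : table rat d [set: 'I_K]) : nat :=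
  (\sum_(i | n i != 0%R) rat_bits (n i))%N.

Definition vec_bits (T : finType) (a : vec rat T) : nat :=
  (\sum_r rat_bits (a r))%N.

Definition linsys_bits (T : finType) (L : linsys rat T) : nat :=
  (\sum_(a <- ineqs L) vec_bits a + \sum_(a <- eqs L) vec_bits a)%N.

Definition ratr_vec (R : realFieldType) (T : finType) (a : vec rat T) :
    vec R T := [ffun r => ratr (a r)].

Definition ratr_linsys (R : realFieldType) (T : finType) (L : linsys rat T) :
    linsys R T :=
  LinSys [seq ratr_vec R a | a <- ineqs L] [seq ratr_vec R a | a <- eqs L].

Definition ratr_table (R : realFieldType) K (d : 'I_K -> nat)
    (V : {set 'I_K}) (n : table rat d V) : table R d V :=
  [ffun i => ratr (n i)].

End Sizes.

(* Main.v *)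
From HB Require Import structures.
Require Import Defs.
From mathcomp Require Import all_boot all_order all_algebra zify.

Set Implicit Arguments.
Unset Strict Implicit.
Unset Printing Implicit Defensive.

Import Order.TTheory GRing.Theory Num.Theory.
Local Open Scope ring_scope.

(* The normal cone of Delta and the polyhedron are polyhedral cones, and the
   two sides of the equivalence say that they are symmetric under c |-> -c. A
   vector c on the faces of a complex is a table i |-> c . a_i, and summing
   the components of a point of the polyhedron gives a point of the normal
   cone of Delta with the sum of the corresponding nonpositive tables. Hence
   if the normal cone is symmetric, then all these tables vanish, so the
   polyhedron is symmetric. Conversely every point of the normal cone arises
   as such a sum: along a decomposition (Gamma_1, S, Gamma_2) a nonpositive
   table f_1 + f_2 is rewritten as a sum of two nonpositive ones by moving
   the function max {f_1(j) : j_S = i_S}, which lives on the block S, from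
   f_1 to f_2. For the size bounds, all faces of Gamma have at most w + 1
   vertices. *)

(** * Linear systems and polar cones *)

Section DotProduct.
Variables (R : realFieldType) (T : finType).
Implicit Types a b c x : vec R T.

Lemma dotC a b : dot a b = dot b a.
Proof. by apply: eq_bigr => r _; rewrite mulrC. Qed.

Lemma dot_is_linear c : linear (dot c : vec R T -> R^o).
Proof.
move=> k x y; rewrite /dot scaler_sumr -big_split; apply: eq_bigr => r _.
by rewrite !ffunE mulrDr /= mulrCA.
Qed.

HB.instance Definition _ c :=
  GRing.isLinear.Build R (vec R T) R^o _ (dot c) (dot_is_linear c).

Lemma dotNl a b : dot (- a) b = - dot a b.
Proof. by rewrite dotC linearN dotC. Qed.

Lemma dotDr c x y : dot c (x + y) = dot c x + dot c y.
Proof. exact: linearD. Qed.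

Lemma dot0r c : dot c 0 = 0.
Proof. exact: linear0. Qed.

Lemma dot_sumZr (I : finType) c (l : I -> R) (a : I -> vec R T) :
  dot c (\sum_i l i *: a i) = \sum_i l i * dot c (a i).
Proof. by rewrite linear_sum; apply: eq_bigr => i _; rewrite linearZ. Qed.

Lemma orthogonal_vspace (s : seq (vec R T)) :
  exists U : {vspace vec R T}, forall x,
    x \in U <-> forall a, a \in s -> dot a x = 0.
Proof.
elim: s => [|a s [U defU]]; first by exists fullv => x; rewrite memvf.
exists (U :&: lker (linfun (dot a : vec R T -> R^o)))%VS => x.
rewrite memv_cap memv_ker lfunE /=.
split=> [/andP[/defU sx /eqP ax] b /[!inE] /predU1P[-> //|/sx //]|sx].
rewrite sx ?mem_head // eqxx andbT; apply/defU => b sb.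
by apply: sx; rewrite inE sb orbT.
Qed.

(** On a symmetric solution set every inequality holds with both signs, so it is an equation there
    and the set is a common kernel. *)
Lemma solves_linear (L : linsys R T) :
  is_linear_space (solves L) <-> forall x, solves L x -> solves L (- x).
Proof.
split=> [[U defU] x /defU Ux|symL]; first by apply/defU; rewrite memvN.
have [U defU] := orthogonal_vspace (ineqs L ++ eqs L).
exists U => x; split=> [Lx|/defU ax].
  apply/defU => a; rewrite mem_cat => /orP[La|]; last exact: Lx.2.
  apply/eqP; rewrite eq_le Lx.1 //= -oppr_le0 -linearN /=.
  exact: (symL _ Lx).1.
by split=> a La; rewrite ax // mem_cat La ?orbT.
Qed.

Lemma orth_lin_hull (P : vec R T -> Prop) c :
  orth (lin_hull P) c <-> forall x, P x -> dot c x = 0.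
Proof.
split=> [oc x Px|oc x hx]; first by apply: oc => U; apply.
have [U defU] := orthogonal_vspace [:: c].
have /defU/(_ c (mem_head _ _)) // : x \in U.
by apply: hx => y /oc cy; apply/defU => a; rewrite inE => /eqP->.
Qed.

End DotProduct.

(** * Tables and marginal cones *)

Section Cells.
Variables (K : nat) (d : 'I_K -> nat).
Implicit Types (V F G S : {set 'I_K}) (i : cell d [set: 'I_K]).

Lemma restr_restr F G V (sFG : F \subset G) (sGV : G \subset V)
    (sFV : F \subset V) (i : cell d V) :
  restr sFG (restr sGV i) = restr sFV i.
Proof.
apply/ffunP => k; rewrite !ffunE /=; congr (i (exist _ _ _)).
exact: bool_irrelevance.
Qed.

Lemma restr_id V (sVV : V \subset V) (i : cell d V) : restr sVV i = i.
Proof.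
apply/ffunP => -[k Vk]; rewrite !ffunE /=; congr (i (exist _ _ _)).
exact: bool_irrelevance.
Qed.

Lemma restr_eqP V F (sFV : F \subset V) (i i' : cell d V) :
  restr sFV i = restr sFV i' <->
  forall k : {k | k \in V}, val k \in F -> i k = i' k.
Proof.
split=> [/ffunP eqi [k Vk] /= Fk|eqi]; last first.
  by apply/ffunP => k; rewrite !ffunE eqi //= (valP k).
have := eqi (exist _ k Fk); rewrite !ffunE /=.
by rewrite (bool_irrelevance (subsetP sFV k _) Vk).
Qed.

Definition overwrite V (j : cell d V) i : cell d [set: 'I_K] :=
  finfun (fun k : {k | k \in [set: 'I_K]} =>
    match decP (@idP (val k \in V)) with
    | left Vk => j (exist _ (val k) Vk)
    | right _ => i k
    end).

Lemma overwriteK V (j : cell d V) i : restr (subsetT V) (overwrite j i) = j.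
Proof.
apply/ffunP => -[k Vk]; rewrite !ffunE /=.
by case: decP => // Vk'; rewrite (bool_irrelevance Vk' Vk).
Qed.

Lemma overwrite_out V (j : cell d V) i (k : {k | k \in [set: 'I_K]}) :
  val k \notin V -> overwrite j i k = i k.
Proof. by rewrite ffunE; case: decP => // Vk /negP. Qed.

(** Coordinates outside [V] get level 0, which exists because every [d j] is positive. Conditions on
    all cells of [V] can thus be tested on full cells. *)
Lemma restr_surj (d_gt0 : forall j, (0 < d j)%N) V (j : cell d V) :
  exists i, restr (subsetT V) i = j.
Proof.
exists (overwrite j (finfun (fun k => Ordinal (d_gt0 (val k))))).
exact: overwriteK.
Qed.

End Cells.

(** * Tables as sums of functions on faces, and splitting of nonpositive tables *)

Section Evaluation.
Variables (R : realFieldType) (K : nat) (d : 'I_K -> nat).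
Implicit Types (V F G S : {set 'I_K}) (Sigma : {set {set 'I_K}}).
Implicit Types (i : cell d [set: 'I_K]) (e : {ffun face_cell d -> R^o}).

Definition face_at F i : face_cell d := Tagged (cell d) (restr (subsetT F) i).

(* e^T a_i, for the design matrix whose rows are indexed by all faces and not
   only by those of a complex. *)
Definition eval i e : R := \sum_F e (face_at F i).

Definition supported e Sigma : Prop := forall r, tag r \notin Sigma -> e r = 0.

Lemma eval_is_linear i : linear (eval i : {ffun face_cell d -> R^o} -> R^o).
Proof.
move=> k x y; rewrite /eval scaler_sumr -big_split; apply: eq_bigr => r _.
by rewrite !ffunE.
Qed.

HB.instance Definition _ i :=
  GRing.isLinear.Build R {ffun face_cell d -> R^o} R^o _ (eval i)
    (eval_is_linear i).

(** Extension by zero puts vectors on different complexes into one space, where they can be added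
    and compared. *)
Definition blocks Sigma (c : vec R (rowidx d Sigma)) :
  {ffun face_cell d -> R^o} := [ffun r => block c r].

Lemma blockE Sigma (c : vec R (rowidx d Sigma)) (r : rowidx d Sigma) :
  block c (val r) = c r.
Proof. by rewrite /block valK. Qed.

Lemma block_out Sigma (c : vec R (rowidx d Sigma)) (r : face_cell d) :
  tag r \notin Sigma -> block c r = 0.
Proof. by move=> r'S; rewrite /block insubN. Qed.

Lemma block_sum Sigma (c : vec R (rowidx d Sigma)) (x : face_cell d) :
  block c x = \sum_(r : rowidx d Sigma) (val r == x)%:R * c r.
Proof.
rewrite /block; case: insubP => [u _ <-|S'x] /=.
  rewrite (bigD1 u) //= eqxx mul1r big1 ?addr0 // => r.
  by rewrite -val_eqE => /negPf->; rewrite mul0r.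
rewrite big1 // => r _; case: eqP => [xr|_]; last by rewrite mul0r.
by rewrite -xr (valP r) in S'x.
Qed.

Lemma face_at_eq r i F :
  (r == face_at F i) = (F == tag r) && (restr (subsetT (tag r)) i == tagged r).
Proof.
case: r => G j /=; have [->|F'G] := eqVneq F G.
  by rewrite eq_sym /face_at; rewrite eq_Tagged.
by apply/negbTE/eqP => /(congr1 tag) /= GF; rewrite GF eqxx in F'G.
Qed.

Lemma dot_column V Sigma (sSV : Sigma \subset powerset V)
    (c : vec R (rowidx d Sigma)) i :
  dot c (column R sSV (restr (subsetT V) i)) = eval i (blocks c).
Proof.
rewrite /eval; under [RHS]eq_bigr do rewrite ffunE block_sum.
rewrite exchange_big; apply: eq_bigr => r _ /=; rewrite -mulr_suml [RHS]mulrC.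
congr (_ * _); rewrite ffunE (restr_restr _ _ (subsetT _)).
rewrite (bigD1 (tag (val r))) //= big1.
  by rewrite addr0 face_at_eq eqxx.
by move=> F /negPf F'r; rewrite face_at_eq F'r.
Qed.

(** Full cells are grouped by their restriction to [V], so that every margin is handled with the
    entries of [n] as coefficients. *)
Lemma suff_stat_margin V Sigma (sSV : Sigma \subset powerset V)
    (n : table R d [set: 'I_K]) :
  suff_stat sSV (margin V n) =
  \sum_i n i *: column R sSV (restr (subsetT V) i).
Proof.
rewrite /suff_stat (partition_big (restr (subsetT V)) xpredT) //=.
apply: eq_bigr => j _; rewrite ffunE scaler_suml.
by apply: eq_bigr => i /eqP->.
Qed.

Lemma margin_setT (n : table R d [set: 'I_K]) : margin [set: 'I_K] n = n.
Proof.
apply/ffunP => i; rewrite ffunE (bigD1 i) ?restr_id ?eqxx //= big1 ?addr0 //.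
by move=> j; rewrite restr_id => /andP[/eqP->]; rewrite eqxx.
Qed.

Lemma dot_suff_stat V Sigma (sSV : Sigma \subset powerset V)
    (n : table R d [set: 'I_K]) (c : vec R (rowidx d Sigma)) :
  dot c (suff_stat sSV (margin V n)) = \sum_i n i * eval i (blocks c).
Proof.
rewrite suff_stat_margin dot_sumZr.
by apply: eq_bigr => i _; rewrite dot_column.
Qed.

Lemma column_in_cone V Sigma (sSV : Sigma \subset powerset V) (i : cell d V) :
  gen_cone sSV (column R sSV i).
Proof.
exists (fun j => (j == i)%:R) => [j|]; first exact: ler0n.
rewrite (bigD1 i) //= eqxx scale1r big1 ?addr0 // => j /negPf->.
exact: scale0r.
Qed.

(** The point 0 of the cone gives the inequality at the statistic t of [m]; the point t + a_j, in
    the cone since [m] is nonnegative, gives the one at the column a_j. Conversely [c] is at most 0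
    on the whole cone. *)
Lemma normal_coneP V Sigma (sSV : Sigma \subset powerset V) (m : table R d V)
    (c : vec R (rowidx d Sigma)) : (forall j, 0 <= m j) ->
  normal_cone sSV m c <->
  (forall j, dot c (column R sSV j) <= 0) /\ 0 <= dot c (suff_stat sSV m).
Proof.
move=> m_ge0; split=> [nc|[c_le0 ct_ge0] _ [l l_ge0 ->]]; last first.
  apply: le_trans ct_ge0; rewrite dot_sumZr; apply: sumr_le0 => i _.
  exact: mulr_ge0_le0.
split=> [j|]; last first.
  rewrite -(dot0r c); apply: nc; exists (fun=> 0) => //.
  by rewrite big1 // => i _; rewrite scale0r.
rewrite -(lerD2r (dot c (suff_stat sSV m))) add0r -dotDr; apply: nc.
exists (fun k => (k == j)%:R + m k) => [k|]; first by rewrite addr_ge0 ?ler0n.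
under eq_bigr do rewrite scalerDl.
rewrite big_split /= (bigD1 j) //= eqxx scale1r big1 ?addr0 // => k /negPf->.
exact: scale0r.
Qed.

(** In this form the conditions for all facets and for the full table range over the same cells with
    the same weights, so they can be added. *)
Lemma normal_cone_margin (d_gt0 : forall j, (0 < d j)%N) V Sigma
    (sSV : Sigma \subset powerset V) (n : table R d [set: 'I_K])
    (c : vec R (rowidx d Sigma)) : (forall i, 0 <= n i) ->
  normal_cone sSV (margin V n) c <->
  (forall i, eval i (blocks c) <= 0) /\ 0 <= \sum_i n i * eval i (blocks c).
Proof.
move=> n_ge0; have nV_ge0 j : 0 <= margin V n j by rewrite ffunE sumr_ge0.
apply: (iff_trans (normal_coneP sSV c nV_ge0)); rewrite dot_suff_stat.
split=> -[c_le0 ct_ge0]; split=> // i.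
  by rewrite -(dot_column sSV).
by have [i' <-] := restr_surj d_gt0 i; rewrite dot_column.
Qed.

Lemma supported_blocks Sigma (c : vec R (rowidx d Sigma)) :
  supported (blocks c) Sigma.
Proof. by move=> r r'S; rewrite ffunE block_out. Qed.

Lemma eval_local e Sigma i i' : supported e Sigma ->
  restr (subsetT (cover Sigma)) i = restr (subsetT (cover Sigma)) i' ->
  eval i e = eval i' e.
Proof.
move=> supp_e /restr_eqP eqi; apply: eq_bigr => F _.
have [SF|S'F] := boolP (F \in Sigma); last by rewrite !supp_e.
congr (e (Tagged _ _)); apply/restr_eqP => k Fk; apply: eqi.
by apply/bigcupP; exists F.
Qed.

(** Overwriting i' by i on [F] changes nothing on [G], since a point of both lies in [S]. *)
Lemma restr_glue F G S i i' : F :&: G = S ->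
    restr (subsetT S) i = restr (subsetT S) i' ->
  exists2 j, restr (subsetT F) j = restr (subsetT F) i &
             restr (subsetT G) j = restr (subsetT G) i'.
Proof.
move=> FGS eqS; exists (overwrite (restr (subsetT F) i) i').
  exact: overwriteK.
apply/restr_eqP => k Gk.
have [Fk|F'k] := boolP (val k \in F); last exact: overwrite_out.
have /restr_eqP/(_ k Fk)-> := overwriteK (restr (subsetT F) i) i'.
by move/restr_eqP: eqS; apply; rewrite -FGS inE Fk.
Qed.

(* The message  m(i_S) = max {e(j) : j_S = i_S}, as a vector on the block S. *)
Lemma max_marginal S e : exists m,
  [/\ supported m [set S], forall i, eval i e <= eval i m &
      forall i, exists2 j,
        restr (subsetT S) j = restr (subsetT S) i & eval i m = eval j e].
Proof.
pose P r := [pred i | face_at S i == r].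
(* The default 0 makes [f] vanish at rows on faces other than [S]. At [face_at S i] the cell [i]
   itself satisfies the predicate, so the maximum is over a nonempty set. *)
pose f r : R^o := if [pick i | P r i] is Some i0
  then eval [arg max_(j > i0 | P r j) (eval j e : R)]%O e else 0.
have suppf : supported (finfun f) [set S].
  move=> r; rewrite inE ffunE /f => S'r; case: pickP => //= i /eqP rS.
  by rewrite -rS eqxx in S'r.
have fE i : eval i (finfun f) = f (face_at S i).
  rewrite /eval (bigD1 S) //= big1 ?addr0 ?ffunE // => F F'S.
  by rewrite suppf // inE.
exists (finfun f); split=> // i; rewrite fE /f; case: pickP => [i0 Pi0|/(_ i)].
- case: Order.TotalTheory.arg_maxP => //= j _; apply; exact: eqxx.
- by rewrite /= eqxx.
- case: Order.TotalTheory.arg_maxP => //= j /eqP Sj _; exists j => //.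
  by move/eqP: Sj; rewrite /face_at eq_Tagged => /eqP.
- by rewrite /= eqxx.
Qed.

(** Pieces are indexed by all faces, not only by facets, because a facet of one part of a
    decomposition need not be a facet of the union. *)
Definition splits Sigma e : Prop :=
  exists c : {set 'I_K} -> {ffun face_cell d -> R^o},
  [/\ forall G, G \notin Sigma -> c G = 0,
      forall G, supported (c G) (powerset G),
      forall G i, eval i (c G) <= 0 & \sum_G c G = e].

Lemma splits_simplex V e : supported e (powerset V) ->
  (forall i, eval i e <= 0) -> splits (powerset V) e.
Proof.
move=> supp_e e_le0; exists (fun G => if G == V then e else 0).
split=> [G|G|G i|].
- by case: eqP => // ->; rewrite powersetE subxx.
- by case: eqP => [->|_] // r _; rewrite ffunE.
- by case: eqP => // _; rewrite linear0.
- by rewrite -big_mkcond big_pred1_eq.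
Qed.

Lemma splitsD Sigma1 Sigma2 e1 e2 :
  splits Sigma1 e1 -> splits Sigma2 e2 -> splits (Sigma1 :|: Sigma2) (e1 + e2).
Proof.
move=> [c1 [out1 supp1 le1 sum1]] [c2 [out2 supp2 le2 sum2]].
exists (fun G => c1 G + c2 G); split=> [G|G r r'G|G i|].
- by rewrite inE negb_or => /andP[/out1-> /out2->]; rewrite addr0.
- by rewrite ffunE supp1 ?supp2 // addr0.
- by rewrite linearD /= -[leRHS]addr0 lerD.
- by rewrite big_split /= sum1 sum2.
Qed.

(* Shifting the max-marginal of the first part over the separator to the second
   part makes both parts nonpositive. *)
Lemma split_decomposition Sigma Sigma1 S Sigma2 e :
    decomposition Sigma Sigma1 S Sigma2 -> supported e Sigma ->
    (forall i, eval i e <= 0) ->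
  exists e1 e2, [/\ e1 + e2 = e, supported e1 Sigma1, supported e2 Sigma2,
    forall i, eval i e1 <= 0 & forall i, eval i e2 <= 0].
Proof.
move=> [_ _ defS covS [S1 S2]] supp_e e_le0.
pose f1 : {ffun face_cell d -> R^o} :=
  [ffun r => if tag r \in Sigma1 then e r else 0].
have supp1 : supported f1 Sigma1 by move=> r /negPf r'1; rewrite ffunE r'1.
have supp2 : supported (e - f1) Sigma2.
  move=> r r'2; rewrite !ffunE; case: ifPn => [_|r'1]; first by rewrite subrr.
  by rewrite supp_e ?subr0 // -defS inE negb_or r'1.
have [m [supp_m le_m max_m]] := max_marginal S f1.
have suppm Sigma' : S \in Sigma' -> supported m Sigma'.
  by move=> S'S r r'S; apply: supp_m; rewrite inE; apply: contraNneq r'S => ->.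
exists (f1 - m), (e - f1 + m); split=> [|r r'1|r r'2|i|i].
- by rewrite addrACA addNr addr0 addrC subrK.
- by rewrite ffunE supp1 // ffunE (suppm _ S1) // oppr0 addr0.
- by rewrite ffunE supp2 // (suppm _ S2) // addr0.
- by rewrite linearB /= subr_le0.
(* The maximum is attained at some j with j_S = i_S. Gluing j on the first part with i on the second
   gives a cell k at which [e] takes the value in question, which is therefore nonpositive. *)
- have [j eqS mE] := max_m i.
  have [k eq1 eq2] := restr_glue covS eqS.
  rewrite linearD /= mE -(eval_local supp1 eq1) -(eval_local supp2 eq2).
  by rewrite -[_ + _]linearD /= subrK.
Qed.

Lemma splits_decomposable Sigma e : decomposable Sigma -> supported e Sigma ->
  (forall i, eval i e <= 0) -> splits Sigma e.
Proof.
(* The recursive occurrences in [decomposable] sit under disjunctions, so the recursion is on the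
   derivation itself. *)
move: Sigma e; fix IH 3.
move=> Sigma0 e0 [Sigma Sigma1 S Sigma2 dec] ds1 ds2 supp_e e_le0.
have [e1 [e2 [<- supp1 supp2 le1 le2]]] := split_decomposition dec supp_e e_le0.
have [_ _ <- _ _] := dec; apply: splitsD.
  case: ds1 => [ds1|[V defV]]; first exact: IH ds1 supp1 le1.
  by rewrite defV in supp1 *; apply: splits_simplex.
case: ds2 => [ds2|[V defV]]; first exact: IH ds2 supp2 le2.
by rewrite defV in supp2 *; apply: splits_simplex.
Qed.

End Evaluation.

(** * The polyhedron of a triangulation *)

Section Polyhedron.
Variables (R : realFieldType) (K : nat) (d : 'I_K -> nat).
Variables (Delta Gamma : {set {set 'I_K}}).
Implicit Types (c : vec R (prodidx d Gamma)) (G : facet Gamma).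
Implicit Types (n : table R d [set: 'I_K]).

Lemma dot_component a c :
  dot a c = \sum_G dot (component a G) (component c G).
Proof.
pose tg G := @Tagged _ G (fun G : facet Gamma => rowidx d (powerset (val G))).
pose F G (r : rowidx d (powerset (val G))) : R := a (tg G r) * c (tg G r).
transitivity (\sum_(x : prodidx d Gamma) F (tag x) (tagged x)).
  by apply: eq_bigr => -[].
have /= <- := sig_big_dep (op := +%R) xpredT (fun=> xpredT) F.
apply: eq_bigr => G _.
by apply: eq_bigr => r _; rewrite !ffunE.
Qed.

Lemma component_embed G (a : vec R (rowidx d (powerset (val G)))) :
  component (embed a) G = a.
Proof. by apply/ffunP => r; rewrite !ffunE untagE. Qed.

Lemma component_embed_neq G G' (a : vec R (rowidx d (powerset (val G)))) :
  G' != G -> component (embed a) G' = 0.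
Proof. by move=> G'G; apply/ffunP => r; rewrite !ffunE untag_dflt. Qed.

Lemma dot_embed G (a : vec R (rowidx d (powerset (val G)))) c :
  dot (embed a) c = dot a (component c G).
Proof.
rewrite dot_component (bigD1 G) //= component_embed big1 ?addr0 // => G' G'G.
by rewrite component_embed_neq // dotC linear0.
Qed.

Lemma componentN c G : component (- c) G = - component c G.
Proof. by apply/ffunP => r; rewrite !ffunE. Qed.

Lemma blockN Sigma (c : vec R (rowidx d Sigma)) r : block (- c) r = - block c r.
Proof. by rewrite /block; case: insub => /= [u|]; rewrite ?ffunE ?oppr0. Qed.

Lemma sum_block c (r : face_cell d) :
  \sum_(G : facet Gamma | tag r \subset val G) block (component c G) r =
  \sum_(G : facet Gamma) block (component c G) r.
Proof.
rewrite big_mkcond; apply: eq_bigr => G _; case: ifPn => // r'G.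
by rewrite block_out // powersetE.
Qed.

Lemma dot_coordinates c (r : face_cell d) :
  dot [ffun x : prodidx d Gamma => (val (tagged x) == r)%:R : R^o] c =
  \sum_(G : facet Gamma | tag r \subset val G) block (component c G) r.
Proof.
rewrite sum_block dot_component; apply: eq_bigr => G _; rewrite block_sum.
by apply: eq_bigr => x _; rewrite !ffunE.
Qed.

(** The margins of [n] are nonnegative, so [normal_coneP] replaces each normal cone by finitely many
    inequalities. *)
Lemma polyhedron_solves n c : (forall i, 0 <= n i) ->
  polyhedron Delta n c <-> solves (description Delta Gamma n) c.
Proof.
move=> n_ge0.
have nG_ge0 (G : facet Gamma) j : 0 <= margin (val G) n j.
  by rewrite ffunE sumr_ge0.
split=> [[nc eq0]|[le0 eq0]]; split.
- move=> a; rewrite mem_cat => /orP[/mapP[x _ ->]|/mapP[G _ ->]].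
    rewrite dot_embed dotC.
    by have /(normal_coneP _ _ (nG_ge0 _))[+ _] := nc (tag x); apply.
  rewrite dotNl oppr_le0 dot_embed dotC.
  by have /(normal_coneP _ _ (nG_ge0 _))[] := nc G.
- move=> a /imageP[[F j] /= GDF ->]; rewrite dot_coordinates.
  exact: eq0.
- move=> G; apply/(normal_coneP _ _ (nG_ge0 _)); split=> [j|].
    rewrite dotC -dot_embed; apply: le0; rewrite mem_cat; apply/orP; left.
    apply/mapP; exists (Tagged (fun G : facet Gamma => cell d (val G)) j) => //.
    by rewrite mem_enum.
  rewrite -oppr_le0 dotC -dot_embed -dotNl; apply: le0; rewrite mem_cat.
  by apply/orP; right; apply/mapP; exists G; rewrite ?mem_enum.
- move=> F GDF j; rewrite -(dot_coordinates c (Tagged (cell d) j)); apply: eq0.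
  by apply/imageP; exists (Tagged (cell d) j).
Qed.

Lemma polyhedronP (d_gt0 : forall j, (0 < d j)%N) n c : (forall i, 0 <= n i) ->
  polyhedron Delta n c <->
  (forall G : facet Gamma, (forall i, eval i (blocks (component c G)) <= 0) /\
             0 <= \sum_i n i * eval i (blocks (component c G))) /\
  (forall r, tag r \in Gamma :\: Delta ->
             \sum_(G : facet Gamma) block (component c G) r = 0).
Proof.
move=> n_ge0; split=> -[nc eq0]; split=> [G|].
- by apply/(normal_cone_margin d_gt0 (subxx _)).
- by move=> [F j] GDF; rewrite -sum_block; apply: eq0.
- by apply/(normal_cone_margin d_gt0 (subxx _)).
- move=> F GDF j; rewrite (sum_block c (Tagged (cell d) j)).
  exact: (eq0 (Tagged (cell d) j)).
Qed.

Lemma polyhedron_linear n : (forall i, 0 <= n i) ->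
  is_linear_space (polyhedron Delta (Gamma := Gamma) n) <->
  forall c, polyhedron Delta n c -> polyhedron Delta n (- c).
Proof.
move=> n_ge0; have polE c := polyhedron_solves c n_ge0.
split=> [[U defU] c /defU Uc|symP]; first by apply/defU; rewrite memvN.
have [c|U defU] := (solves_linear (description Delta Gamma n)).2.
  by move/polE/symP/polE.
by exists U => c; split=> [/polE/defU|/defU/polE].
Qed.

End Polyhedron.

Section FaceCone.
Variables (R : realFieldType) (K : nat) (d : 'I_K -> nat).
Variables (V : {set 'I_K}) (Sigma : {set {set 'I_K}}).
Variables (sSV : Sigma \subset powerset V) (m : table R d V).
Hypothesis m_ge0 : forall j, 0 <= m j.

Lemma orth_hull_gen_cone (c : vec R (rowidx d Sigma)) :
  orth (lin_hull (gen_cone sSV)) c <->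
  forall j, dot c (column R sSV j) = 0.
Proof.
apply: (iff_trans (orth_lin_hull _ _)); split=> [oc j|oc _ [l _ ->]].
  exact/oc/column_in_cone.
by rewrite dot_sumZr big1 // => j _; rewrite oc mulr0.
Qed.

(** The orthogonal complement of the columns always lies in the normal cone and is closed under
    negation. If the normal cone is symmetric, the inequalities at a column for c and - c make c
    vanish there. *)
Lemma normal_cone_orth_hull :
  (forall c : vec R (rowidx d Sigma),
     normal_cone sSV m c <-> orth (lin_hull (gen_cone sSV)) c) <->
  (forall c, normal_cone sSV m c -> normal_cone sSV m (- c)).
Proof.
split=> [eqo c /eqo/orth_hull_gen_cone oc|symN c].
  by apply/eqo/orth_hull_gen_cone => j; rewrite dotNl oc oppr0.
apply: (iff_trans _ (iff_sym (orth_hull_gen_cone c))).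
split=> [nc j|oc]; last first.
  apply/(normal_coneP _ _ m_ge0); split=> [j|]; first by rewrite oc.
  by rewrite dot_sumZr big1 // => j _; rewrite oc mulr0.
apply/eqP; rewrite eq_le.
have /(normal_coneP _ _ m_ge0)[-> _] := nc.
have /(normal_coneP _ _ m_ge0)[/(_ j)] := symN _ nc.
by rewrite dotNl oppr_le0 => ->.
Qed.

End FaceCone.

Section Facets.
Variables (K : nat) (Gamma : {set {set 'I_K}}).

Lemma facet_mem (G : facet Gamma) : val G \in Gamma.
Proof. by have := valP G; rewrite inE => /maxsetp. Qed.

Lemma facet_above F : F \in Gamma -> exists G : facet Gamma, F \subset val G.
Proof.
move=> /(@maxset_exists _ (fun C => C \in Gamma))[G maxG FG].
have facetG : G \in facets Gamma by rewrite inE.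
by exists (exist _ G facetG).
Qed.

Lemma decomposable_complex : decomposable Gamma -> is_complex Gamma.
Proof.
case=> Sigma Sigma1 S Sigma2 [[S1_0 S1_sub] [_ S2_sub] <- _ _] _ _.
split=> [|F G]; first by rewrite inE S1_0.
rewrite !inE => /orP[G1|G2] FG; first by rewrite (S1_sub F G).
by rewrite (S2_sub F G) ?orbT.
Qed.

End Facets.

(** * Passing between the normal cone and the polyhedron *)

Section Splitting.
Variables (R : realFieldType) (K : nat) (d : 'I_K -> nat).
Variables (Delta Gamma : {set {set 'I_K}}) (n : table R d [set: 'I_K]).
Hypotheses (d_gt0 : forall j, (0 < d j)%N) (n_ge0 : forall i, 0 <= n i).
Hypotheses (sDG : Delta \subset Gamma) (complexG : is_complex Gamma).
Implicit Types (c : vec R (rowidx d Delta)) (q : vec R (prodidx d Gamma)).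

Lemma blocksN Sigma (c : vec R (rowidx d Sigma)) : blocks (- c) = - blocks c.
Proof. by apply/ffunP => r; rewrite !ffunE blockN. Qed.

Lemma normal_cone_setT c :
  normal_cone (sub_powersetT Delta) n c <->
  (forall i, eval i (blocks c) <= 0) /\ 0 <= \sum_i n i * eval i (blocks c).
Proof. by rewrite -{1}[n]margin_setT; apply: normal_cone_margin. Qed.

(** The equations kill the blocks of the sum on [Gamma :\: Delta], so the sum is a vector on
    [Delta]; the inequalities of the cones add up. *)
Lemma polyhedron_sum q : polyhedron Delta n q -> exists2 c,
  normal_cone (sub_powersetT Delta) n c &
  blocks c = \sum_(G : facet Gamma) blocks (component q G).
Proof.
move=> /(polyhedronP _ d_gt0 _ n_ge0)[nc eq0].
pose c : vec R (rowidx d Delta) :=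
  [ffun r => \sum_(G : facet Gamma) block (component q G) (val r)].
have defc : blocks c = \sum_(G : facet Gamma) blocks (component q G).
  apply/ffunP => r; rewrite ffunE sum_ffunE.
  under [RHS]eq_bigr do rewrite ffunE.
  have [Dr|D'r] := boolP (tag r \in Delta).
    by rewrite -[r](SubK (rowidx d Delta) Dr) blockE ffunE.
  rewrite block_out //; have [Gr|G'r] := boolP (tag r \in Gamma).
    by rewrite eq0 // inE D'r.
  rewrite big1 // => G _; rewrite block_out // powersetE.
  by apply: contra G'r; apply: complexG.2; apply: facet_mem.
exists c => //; apply/normal_cone_setT; rewrite defc; split=> [i|].
  by rewrite linear_sum sumr_le0 //= => G _; have [->] := nc G.
under eq_bigr do rewrite linear_sum mulr_sumr.
by rewrite exchange_big sumr_ge0 //= => G _; have [] := nc G.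
Qed.

Lemma polyhedron_lift c : splits Gamma (blocks c) ->
    normal_cone (sub_powersetT Delta) n c -> exists2 q,
  polyhedron Delta n q &
  blocks c = \sum_(G : facet Gamma) blocks (component q G).
Proof.
move=> [f [f_out f_supp f_le0 f_sum]] /normal_cone_setT[c_le0 ct_ge0].
have [G0 _] := facet_above complexG.1.
(* Each face is assigned to one facet containing it. The default [G0] is only returned for sets
   outside [Gamma], where [f] is 0. *)
pose h (F : {set 'I_K}) := odflt G0 [pick G : facet Gamma | F \subset val G].
have hP F : F \in Gamma -> F \subset val (h F).
  move=> /facet_above[G FG]; rewrite /h; case: pickP => //= /(_ G).
  by rewrite FG.
pose g G : {ffun face_cell d -> R^o} := \sum_(F | h F == G) f F.
pose q : vec R (prodidx d Gamma) := [ffun x => g (tag x) (val (tagged x))].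
have g_le0 G i : eval i (g G) <= 0.
  by rewrite linear_sum sumr_le0 //= => F _; apply: f_le0.
have gE G : blocks (component q G) = g G.
  apply/ffunP => r; rewrite ffunE.
  have [Gr|G'r] := boolP (tag r \in powerset (val G)).
    by rewrite -[r](SubK (rowidx d (powerset (val G))) Gr) blockE !ffunE.
  rewrite block_out // sum_ffunE big1 // => F /eqP hF.
  have [FG|F'G] := boolP (F \in Gamma); last by rewrite f_out // ffunE.
  apply: f_supp; move: G'r; rewrite !powersetE; apply: contra => rF.
  by rewrite -hF (subset_trans rF) // hP.
have g_sum : blocks c = \sum_G g G.
  by rewrite -f_sum (partition_big h xpredT).
have sumE : blocks c = \sum_(G : facet Gamma) blocks (component q G).
  by rewrite g_sum; apply: eq_bigr => G _; rewrite gE.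
exists q => //; apply/(polyhedronP _ d_gt0 _ n_ge0); split=> [G|r].
  (* The other pieces are nonpositive, so the table of [c] lies below that of the piece [g G],
     pointwise and hence in the sum weighted by [n]. *)
  rewrite gE; split=> //; apply: (le_trans ct_ge0); apply: ler_sum => i _.
  rewrite ler_wpM2l // g_sum linear_sum (bigD1 G) //= gerDl sumr_le0 //.
rewrite inE => /andP[D'r _].
transitivity (blocks c r); last by rewrite ffunE block_out.
by rewrite sumE sum_ffunE; apply: eq_bigr => G _; rewrite ffunE.
Qed.

Lemma symmetric_polyhedron :
    (forall c, normal_cone (sub_powersetT Delta) n c ->
               normal_cone (sub_powersetT Delta) n (- c)) ->
  forall q, polyhedron Delta n q -> polyhedron Delta n (- q).
Proof.
move=> symN q Pq; have [c nc defc] := polyhedron_sum Pq.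
move: Pq => /(polyhedronP _ d_gt0 _ n_ge0)[nq eq0].
have c0 i : eval i (blocks c) = 0.
  have /normal_cone_setT[c_le0 _] := nc.
  have /normal_cone_setT[/(_ i) + _] := symN c nc.
  rewrite blocksN linearN oppr_le0 /= => c_ge0.
  by apply/eqP; rewrite eq_le c_le0 c_ge0.
have q0 (G : facet Gamma) i : eval i (blocks (component q G)) = 0.
  apply: oppr_inj; rewrite oppr0; move: G (isT); apply: psumr_eq0P => [G' _|].
    by rewrite oppr_ge0; have [->] := nq G'.
  by rewrite sumrN -linear_sum /= -defc c0 oppr0.
apply/(polyhedronP _ d_gt0 _ n_ge0); split=> [G|r /eq0 r0].
  have qN0 i : eval i (blocks (component (- q) G)) = 0.
    by rewrite componentN blocksN linearN /= q0 oppr0.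
  split=> [i|]; first by rewrite qN0.
  by rewrite big1 // => i _; rewrite qN0 mulr0.
under eq_bigr do rewrite componentN blockN.
by rewrite sumrN r0 oppr0.
Qed.

Lemma symmetric_normal_cone : decomposable Gamma ->
    (forall q, polyhedron Delta n q -> polyhedron Delta n (- q)) ->
  forall c, normal_cone (sub_powersetT Delta) n c ->
            normal_cone (sub_powersetT Delta) n (- c).
Proof.
move=> decG symP c nc; have /normal_cone_setT[c_le0 _] := nc.
have splits_c : splits Gamma (blocks c).
  apply: splits_decomposable => // r r'G; apply: supported_blocks.
  exact: contra (subsetP sDG _) r'G.
have [q Pq defc] := polyhedron_lift splits_c nc.
have /symP/(polyhedronP _ d_gt0 _ n_ge0)[nq _] := Pq.
(* The inequalities for [- q] make every component table of [q] nonnegative, so their sum, the table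
   of [c], is both nonpositive and nonnegative. *)
have c0 i : eval i (blocks c) = 0.
  apply/eqP; rewrite eq_le c_le0 defc linear_sum sumr_ge0 //= => G _.
  by have [/(_ i) + _] := nq G; rewrite componentN blocksN linearN oppr_le0.
apply/normal_cone_setT; split=> [i|].
  by rewrite blocksN linearN /= c0 oppr0.
by rewrite big1 // => i _; rewrite blocksN linearN /= c0 oppr0 mulr0.
Qed.

End Splitting.

(** * Size of the description *)

Section RationalBits.
Local Open Scope nat_scope.

(** Numerator plus denominator instead of their maximum, for which 1 + 1 would already violate
    [heightD]. *)
Definition height (q : rat) : nat := `|numq q| + `|denq q|.

Lemma absz_leqD (a b : int) : `|(a + b)%R| <= `|a| + `|b|.
Proof. by rewrite -lez_nat PoszD !abszE ler_normD. Qed.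

(** A fraction is its reduced form expanded by a nonzero integer, which cannot make either term
    smaller. *)
Lemma height_frac (n d : int) : d != 0%R ->
  height (n%:~R / d%:~R)%R <= `|n| + `|d|.
Proof.
case: divqP => [_|k x k0]; first by rewrite eqxx.
by move=> _; rewrite !abszM -mulnDr leq_pmull // absz_gt0.
Qed.

(* Unlike the bit size, the height of a sum needs no additive constant. *)
Lemma heightD x y : height (x + y)%R <= height x * height y.
Proof.
rewrite -{1}[x]divq_num_den -{1}[y]divq_num_den addf_div.
2,3: by rewrite intr_eq0 denq_neq0.
rewrite -!intrM -intrD; apply: leq_trans (height_frac _ _) _.
  by rewrite mulf_neq0 ?denq_neq0.
rewrite abszM (leq_trans (leq_add (absz_leqD _ _) (leqnn _))) // !abszM.
rewrite /height; nia.
Qed.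

Lemma ltn_nat_bits m : m < 2 ^ nat_bits m.
Proof. exact: trunc_log_ltn. Qed.

(** The 1 is for m = k = 0: zero has bit size 1. *)
Lemma nat_bits_leq m k : m < 2 ^ k -> nat_bits m <= maxn 1 k.
Proof.
case: m => [|m] mk; first by rewrite /nat_bits trunc_log0 leq_maxl.
rewrite leq_max orbC -(ltn_exp2l _ _ (ltnSn 1)).
by rewrite (leq_ltn_trans (trunc_logP _ _) mk).
Qed.

Lemma height_leq_bits q : height q <= 2 ^ rat_bits q.
Proof.
rewrite /rat_bits /height -addnA expnD.
set a := nat_bits _; set b := nat_bits _.
have := ltn_nat_bits `|numq q|; have := ltn_nat_bits `|denq q|.
rewrite -/a -/b expnD.
have := expn_gt0 2 a; have := expn_gt0 2 b.
nia.
Qed.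

Lemma rat_bits_leq q k : height q <= 2 ^ k -> rat_bits q <= 3 + k.*2.
Proof.
(* Numerator and denominator are at most 2 ^ k, which takes k + 1 bits each. *)
have bits m : m <= 2 ^ k -> nat_bits m <= k.+1.
  move=> mk; rewrite -(maxn_idPr (ltn0Sn k)) nat_bits_leq //.
  by rewrite (leq_ltn_trans mk) // ltn_exp2l.
rewrite /height /rat_bits => hk.
have := bits _ (leq_trans (leq_addr _ _) hk).
have := bits _ (leq_trans (leq_addl _ _) hk).
lia.
Qed.

Lemma rat_bitsN q : rat_bits (- q)%R = rat_bits q.
Proof. by rewrite /rat_bits numqN denqN abszN. Qed.

(** Heights multiply, so their exponents add, and the constant 3 is paid once instead of once per
    summand. Zero terms are dropped first, as in [table_bits]. *)
Lemma rat_bits_sum (I : finType) (P : pred I) (f : I -> rat) :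
  rat_bits (\sum_(i | P i) f i)%R <=
  3 + (\sum_(i | f i != 0%R) rat_bits (f i)).*2.
Proof.
apply: rat_bits_leq.
have -> : (\sum_(i | P i) f i)%R = (\sum_(i | P i && (f i != 0)) f i)%R.
  rewrite big_mkcond [RHS]big_mkcond; apply: eq_bigr => i _.
  by case: (P i); case: eqP.
apply: (@leq_trans (2 ^ \sum_(i | P i && (f i != 0%R)) rat_bits (f i))).
  apply: (big_ind2 (fun x k => height x <= 2 ^ k)) => // [x k y l xk yl|i _].
    by rewrite expnD (leq_trans (heightD _ _)) // leq_mul.
  exact: height_leq_bits.
rewrite leq_exp2l // [leqRHS](bigID P) /=.
by under eq_bigl do rewrite andbC; apply: leq_addr.
Qed.

End RationalBits.

(** * Counting small faces and their cells *)

Section Counting.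
Local Open Scope nat_scope.
Variables (K : nat) (d : 'I_K -> nat).
Implicit Types (F V : {set 'I_K}) (Sigma : {set {set 'I_K}}).

Lemma expn_homo e : {homo expn ^~ e : a b / a <= b}.
Proof. by case: e => // e a b ab; rewrite leq_exp2r. Qed.

Lemma card_small_sets Sigma m : (forall F, F \in Sigma -> #|F| <= m) ->
  #|Sigma| <= K.+1 ^ m.
Proof.
move=> small.
(* A set with at most m points is listed by m entries, with [None] as padding; this gives K + 1
   choices per entry. *)
pose f (t : {ffun 'I_m -> option 'I_K}) := [set x | Some x \in codom t].
apply: (@leq_trans #|f @: setT|); last first.
  rewrite (leq_trans (leq_imset_card _ _)) //.
  by rewrite cardsT card_ffun card_option !card_ord.
apply/subset_leq_card/subsetP => F /small Fm; apply/imsetP.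
exists [ffun i : 'I_m => nth None [seq Some x | x <- enum F] i] => //.
apply/setP => x; rewrite inE; apply/idP/codomP => [Fx|[i]].
  have xF : index x (enum F) < #|F| by rewrite cardE index_mem mem_enum.
  exists (Ordinal (leq_trans xF Fm)); rewrite ffunE /=.
  by rewrite (nth_map x) ?nth_index ?mem_enum // -cardE.
rewrite ffunE; case: (ltnP i #|F|) => [iF|Fi]; last first.
  by rewrite nth_default // size_map -cardE.
by rewrite (nth_map x) -?cardE // => -[->]; rewrite -mem_enum mem_nth // -cardE.
Qed.

(** The sum of all levels bounds each [d j], so cells embed into functions with a single
    codomain. *)
Lemma card_cell V : #|cell d V| <= (\sum_j d j) ^ #|V|.
Proof.
have dD j : d j <= \sum_j d j by rewrite (bigD1 j) ?leq_addr.
pose f (i : cell d V) : {ffun {j | j \in V} -> 'I_(\sum_j d j)} :=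
  [ffun k => widen_ord (dD (val k)) (i k)].
have f_inj : injective f.
  move=> i i' /ffunP eqf; apply/ffunP => k; have := eqf k; rewrite !ffunE.
  by move/(congr1 val) => /= /val_inj.
by rewrite (leq_trans (leq_card f f_inj)) // card_ffun card_ord card_sig.
Qed.

Lemma card_sigma_leq (I : finType) (J : I -> finType) b :
  (forall i, #|J i| <= b) -> #|{: {i : I & J i}}| <= #|I| * b.
Proof.
move=> leb; rewrite card_tagged sumnE big_map big_enum.
by rewrite -sum_nat_const leq_sum.
Qed.

Lemma card_face_cells Sigma m M : K < M -> \sum_j d j < M ->
    (forall F, F \in Sigma -> #|F| <= m) ->
  #|[pred r : face_cell d | tag r \in Sigma]| <= M ^ (m + m).
Proof.
move=> KM dM small.
have -> : #|[pred r : face_cell d | tag r \in Sigma]| =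
    \sum_(F in Sigma) #|cell d F|.
  rewrite -sum1_card; under [RHS]eq_bigr do rewrite -sum1_card.
  by rewrite sig_big_dep /=; apply: eq_bigl => r; rewrite inE andbT.
apply: (@leq_trans (\sum_(F in Sigma) M ^ m)).
  apply: leq_sum => F /small Fm; apply: (leq_trans (card_cell F)).
  apply: (@leq_trans (M ^ #|F|)); first exact/expn_homo/ltnW.
  by rewrite leq_pexp2l // (leq_ltn_trans _ KM).
rewrite sum_nat_const expnD leq_mul2r.
rewrite (leq_trans (card_small_sets small)) ?orbT //.
exact: expn_homo.
Qed.

End Counting.

(** * Dimension and bit size for faces with at most [m] vertices *)

Section DescriptionSize.
Local Open Scope nat_scope.
Variables (K : nat) (d : 'I_K -> nat) (Gamma : {set {set 'I_K}}) (m M : nat).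
Hypotheses (ltKM : K < M) (ltdM : \sum_j d j < M).
Hypothesis small : forall F, F \in Gamma -> #|F| <= m.

Lemma card_facet : #|facet Gamma| <= M ^ m.
Proof.
rewrite card_sig; apply: leq_trans (expn_homo m ltKM).
apply: leq_trans (card_small_sets small); apply/subset_leq_card/subsetP => G.
by rewrite !inE => /maxsetp.
Qed.

Lemma card_prodidx : #|prodidx d Gamma| <= M ^ (3 * m).
Proof.
have -> : 3 * m = m + (m + m) by lia.
rewrite expnD; apply: leq_trans (leq_mul card_facet (leqnn _)).
apply: card_sigma_leq => G; rewrite card_sig.
apply: card_face_cells => // F; rewrite powersetE => /subset_leq_card FG.
exact: leq_trans FG (small (facet_mem G)).
Qed.

Lemma card_facet_cells :
  #|{: {G : facet Gamma & cell d (val G)}}| <= M ^ (m + m).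
Proof.
rewrite expnD; apply: leq_trans (leq_mul card_facet (leqnn _)).
apply: card_sigma_leq => G; apply: (leq_trans (card_cell _ _)).
apply: (@leq_trans (M ^ #|val G|)); first exact/expn_homo/ltnW.
by rewrite leq_pexp2l ?small ?facet_mem // (leq_ltn_trans _ ltKM).
Qed.

Lemma vec_bits_leq (T : finType) (a : vec rat T) b :
  (forall x, rat_bits (a x) <= b) -> vec_bits a <= #|T| * b.
Proof. by move=> ab; rewrite -sum_nat_const; apply: leq_sum. Qed.

Lemma sum_vec_bits_leq (T : finType) (s : seq (vec rat T)) b :
  (forall a, a \in s -> vec_bits a <= b) ->
  \sum_(a <- s) vec_bits a <= size s * b.
Proof.
move=> sb; rewrite -sum1_size big_distrl /= !big_seq.
by apply: leq_sum => a sa; rewrite mul1n sb.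
Qed.

Lemma rat_bits_bool (b : bool) : rat_bits b%:R%R = 3.
Proof. by case: b. Qed.

Lemma rat_bits_embed (G : facet Gamma)
    (a : vec rat (rowidx d (powerset (val G)))) b x :
  3 <= b -> (forall r, rat_bits (a r) <= b) -> rat_bits (embed a x) <= b.
Proof.
move=> b3 ab; rewrite ffunE; have [xG|x'G] := eqVneq (tag x) G.
  by rewrite (untagE _ _ xG).
by rewrite untag_dflt // (rat_bits_bool false).
Qed.

(** An entry is the sum of [n] over the full cells restricting to the cell of the row, so no bound
    on the margin itself is required. *)
Lemma rat_bits_suff_stat (V : {set 'I_K}) (Sigma : {set {set 'I_K}})
    (sSV : Sigma \subset powerset V) (n : table rat d [set: 'I_K]) r :
  rat_bits (suff_stat sSV (margin V n) r) <= 3 + (table_bits n).*2.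
Proof.
rewrite suff_stat_margin sum_ffunE.
pose P i := restr (rowidx_sub sSV r) (restr (subsetT V) i) == tagged (val r).
rewrite (_ : (\sum_i _)%R = (\sum_(i | P i) n i)%R); first exact: rat_bits_sum.
rewrite [RHS]big_mkcond; apply: eq_bigr => i _; rewrite !ffunE -/(P i).
by case: (P i); [exact: mulr1 | exact: mulr0].
Qed.

Lemma description_bits Delta (n : table rat d [set: 'I_K]) :
  table_bits n < M ->
  linsys_bits (description Delta Gamma n) <= 9 * M ^ (5 * m).+1.
Proof.
move=> ltnM; have M_gt0 : 0 < M by apply: leq_ltn_trans ltnM.
(* A vector has at most M ^ (3 m) entries, each of at most 3 + 2 (M - 1) <= 3 M bits. *)
pose W := M ^ (3 * m) * (3 * M).
have leW (a : vec rat (prodidx d Gamma)) :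
    (forall x, rat_bits (a x) <= 3 * M) -> vec_bits a <= W.
  move=> aM; apply: (leq_trans (vec_bits_leq aM)).
  by rewrite leq_mul2r card_prodidx orbT.
rewrite /linsys_bits.
have ineqsP : \sum_(a <- ineqs (description Delta Gamma n)) vec_bits a <=
    (M ^ (m + m) + M ^ m) * W.
  apply: (leq_trans (sum_vec_bits_leq (b := W) _)) => [a|]; last first.
    rewrite leq_mul2r size_cat !size_image.
    by rewrite leq_add ?card_facet ?card_facet_cells ?orbT.
  rewrite mem_cat => /orP[/mapP[x _ ->]|/mapP[G _ ->]]; apply: leW => y.
    by apply: rat_bits_embed => [|r]; rewrite ?ffunE ?rat_bits_bool; lia.
  rewrite ffunE rat_bitsN; apply: rat_bits_embed => [|r]; first by lia.
  by apply: leq_trans (rat_bits_suff_stat _ _ _) _; lia.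
have eqsP : \sum_(a <- eqs (description Delta Gamma n)) vec_bits a <=
    M ^ (m + m) * W.
  apply: (leq_trans (sum_vec_bits_leq (b := W) _)) => [a|]; last first.
    rewrite leq_mul2r size_image card_face_cells ?orbT // => F.
    by rewrite inE => /andP[_ /small].
  move=> /imageP[r _ ->]; apply: leW => y; rewrite ffunE rat_bits_bool; lia.
apply: (leq_trans (leq_add ineqsP eqsP)).
(* There are at most 3 M ^ (2 m) vectors of at most W bits, and W = 3 M ^ (3 m + 1). *)
rewrite -mulnDl (_ : 9 * _ = 3 * M ^ (m + m) * W); last first.
  rewrite /W (_ : (5 * m).+1 = (m + m) + 3 * m + 1) ?expnD ?expn1; lia.
rewrite leq_mul2r; apply/orP; right.
have : M ^ m <= M ^ (m + m) by rewrite leq_pexp2l // leq_addr.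
lia.
Qed.

End DescriptionSize.

(** * Change of scalars from the rationals *)

Section RationalDescription.
Variables (R : realFieldType) (K : nat) (d : 'I_K -> nat).
Implicit Types (V : {set 'I_K}) (Sigma Delta Gamma : {set {set 'I_K}}).

Lemma ratr_vec_embed Gamma (G : facet Gamma)
    (a : vec rat (rowidx d (powerset (val G)))) :
  ratr_vec R (embed a) = embed (ratr_vec R a).
Proof.
apply/ffunP => x; rewrite !ffunE; have [xG|x'G] := eqVneq (tag x) G.
  by rewrite !(untagE _ _ xG) ffunE.
by rewrite !untag_dflt // rmorph0.
Qed.

Lemma ratr_vec_column V Sigma (sSV : Sigma \subset powerset V) (i : cell d V) :
  ratr_vec R (column rat sSV i) = column R sSV i.
Proof. by apply/ffunP => r; rewrite !ffunE ratr_nat. Qed.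

Lemma ratr_vec_suff_stat V Sigma (sSV : Sigma \subset powerset V)
    (n : table rat d [set: 'I_K]) :
  ratr_vec R (suff_stat sSV (margin V n)) =
  suff_stat sSV (margin V (ratr_table R n)).
Proof.
apply/ffunP => r; rewrite !suff_stat_margin ffunE !sum_ffunE rmorph_sum.
by apply: eq_bigr => i _; rewrite !ffunE rmorphM /= ratr_nat.
Qed.

(** Bit sizes are measured on the rational system, whereas the polyhedron is taken over an arbitrary
    real field; this identifies the two descriptions. *)
Lemma ratr_description Delta Gamma (n : table rat d [set: 'I_K]) :
  ratr_linsys R (description Delta Gamma n) =
  description Delta Gamma (ratr_table R n).
Proof.
rewrite /ratr_linsys /description /image_mem /= map_cat -!map_comp.
congr (LinSys (_ ++ _) _); apply: eq_map => x /=.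
- by rewrite ratr_vec_embed ratr_vec_column.
- rewrite -ratr_vec_suff_stat -ratr_vec_embed.
  by apply/ffunP => y; rewrite !ffunE rmorphN.
- by apply/ffunP => y; rewrite !ffunE ratr_nat.
Qed.

Lemma dim_vec (T : finType) : \dim {: vec R T} = #|T|.
Proof. by rewrite dimvf /dim /= muln1. Qed.

End RationalDescription.

Lemma width_leq K (Gamma : {set {set 'I_K}}) w :
  width Gamma <= w%:Z -> forall F, F \in Gamma -> (#|F| <= w.+1)%N.
Proof.
rewrite /width lerBlDr -PoszD lez_nat addn1 => /bigmax_leqP Gw F.
exact: Gw.
Qed.

Theorem theorem8 :
  (forall (R : realFieldType) (K : nat) (d : 'I_K -> nat)
      (Delta Gamma : {set {set 'I_K}}) (n : table R d [set: 'I_K]),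
    (forall j, (0 < d j)%N) ->
    (forall i, 0 <= n i) ->
    is_complex Delta ->
    chordal_triangulation Delta Gamma ->
    ((forall c : vec R (rowidx d Delta),
        normal_cone (sub_powersetT Delta) n c <->
        orth (lin_hull (gen_cone (sub_powersetT Delta))) c) <->
     is_linear_space (polyhedron Delta (Gamma := Gamma) n))) /\
  (forall w : nat, exists p : {poly nat},
    forall (K : nat) (d : 'I_K -> nat)
      (Delta Gamma : {set {set 'I_K}}) (n : table rat d [set: 'I_K]) (tw : int),
    (forall j, (0 < d j)%N) ->
    (forall i, 0 <= n i) ->
    is_complex Delta ->
    chordal_triangulation Delta Gamma ->
    is_treewidth Delta tw -> tw <= w%:Z ->
    let bound := p.[(K + \sum_(j < K) d j + table_bits n)%N] in
    [/\ forall (R : realFieldType) (c : vec R (prodidx d Gamma)),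
          polyhedron Delta (ratr_table R n) c <->
          solves (ratr_linsys R (description Delta Gamma n)) c,
        (linsys_bits (description Delta Gamma n) <= bound)%N &
        forall R : realFieldType, (\dim {: vec R (prodidx d Gamma)} <= bound)%N]).
Proof.
split=> [R K d Delta Gamma n d_gt0 n_ge0 _ [[decG sDG] _]|w].
  have complexG := decomposable_complex decG.
  apply: (iff_trans (normal_cone_orth_hull _ n_ge0)).
  apply: (iff_trans _ (iff_sym (polyhedron_linear Delta Gamma n_ge0))).
  split; [exact: symmetric_polyhedron | exact: symmetric_normal_cone].
(* This is the bound of [description_bits] for m = w + 1 and M one more than the input size, so that
   M exceeds each of its three summands. *)
exists (9 *: ('X + 1%:P) ^+ (5 * w.+1).+1).
move=> K d Delta Gamma n tw _ n_ge0 _ [_ [_ min_width]] [[G' covG' <-] _] le_w.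
set N := (K + _ + _)%N => bound.
(* The cover G' realizes [tw], and the width of [Gamma] is minimal, so it is at most [tw] and hence
   at most [w]. *)
have small := width_leq (le_trans (min_width _ covG') le_w).
have -> : bound = (9 * N.+1 ^ (5 * w.+1).+1)%N.
  rewrite /bound hornerZ horner_exp hornerD hornerX hornerC.
  by rewrite natrME natrXE natrDE addn1.
have ltKN : (K < N.+1)%N by rewrite ltnS /N -addnA leq_addr.
have ltdN : (\sum_j d j < N.+1)%N by rewrite ltnS /N addnAC leq_addl.
have ltnN : (table_bits n < N.+1)%N by rewrite ltnS /N leq_addl.
split=> [R c||R].
- rewrite ratr_description; apply: polyhedron_solves => i.
  by rewrite ffunE ler0q.
- exact: description_bits.
- rewrite dim_vec (leq_trans (card_prodidx ltKN ltdN small)) //.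
  apply: (@leq_trans (N.+1 ^ (5 * w.+1).+1)); last by rewrite leq_pmull.
  by rewrite leq_pexp2l //; lia.
Qed.
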